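(* There exists no finite affine plane of order $6$ (equivalently, there exists no finite projective plane of order $6$). The finite projective plane of order $7$ is unique up to isomorphism, i.e. a projective plane of order $7$ exists and any two projective planes of order $7$ are isomorphic.
   Context: A finite affine plane of order $n$ is a set $\mathcal{A}=\{P_1,\dots,P_{n^2}\}$ of $n^2$ points together with $n+1$ parallel classes $L_1,\dots,L_{n+1}$, where each $L_i=\{\ell_i^{(0)},\dots,\ell_i^{(n-1)}\}$ is a collection of $n$ distinct, pairwise disjoint (parallel) subsets of $\mathcal{A}$ called lines, each containing exactly $n$ points of $\mathcal{A}$, such that for all $i\neq j$ and all $k,m$ the intersection $\ell_i^{(k)}\cap \ell_j^{(m)}$ consists of exactly one point. A finite projective plane of order $n$ is the disjoint union of (the point set of) a finite affine plane $\mathcal{A}$ of order $n$ and a ''line at infinity'' $\ell_\infty=\{P_1^{(\infty)},\dots,P_{n+1}^{(\infty)}\}$ of $n+1$ further points. Its lines are $\ell_\infty$ together with the sets $\ell_i^{(k)}\cup\{P_i^{(\infty)}\}$ for $1\le i\le n+1$, $0\le k\le n-1$; that is, $P_i^{(\infty)}$ is the intersection point of any two distinct lines of the parallel class $L_i$. Two projective planes are isomorphic if there is a bijection between their point sets that maps the set of lines of one onto the set of lines of the other. *)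

(* Defs.v *)
From mathcomp Require Import all_boot.

Set Implicit Arguments.
Unset Strict Implicit.
Unset Printing Implicit Defensive.

(* The n + 1 parallel classes are the families [L i], with i : 'I_n.+1, and
   [L i k], with k : 'I_n, is the k-th line of the class [L i].  The point set
   is a subset [A] of [T], so that the same definition applies both to an
   affine plane and to the affine part of a projective plane. *)
Record is_affine_plane (n : nat) (T : finType) (A : {set T})
    (L : 'I_n.+1 -> 'I_n -> {set T}) : Prop := IsAffinePlane {
  affine_card : #|A| = n ^ 2;
  affine_line_sub : forall i k, L i k \subset A;
  affine_line_card : forall i k, #|L i k| = n;
  affine_line_inj : forall i, injective (L i);
  affine_parallel : forall i k m, k != m -> [disjoint L i k & L i m];
  affine_meet : forall i j k m, i != j -> #|L i k :&: L j m| = 1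
}.
Arguments is_affine_plane n {T} A L.

Definition line_at_infinity (n : nat) (T : finType) (Pinf : 'I_n.+1 -> T)
    : {set T} :=
  [set Pinf i | i : 'I_n.+1].

Definition projective_lines (n : nat) (T : finType)
    (L : 'I_n.+1 -> 'I_n -> {set T}) (Pinf : 'I_n.+1 -> T) : {set {set T}} :=
  line_at_infinity Pinf
    |: [set Pinf i |: L i k | i : 'I_n.+1, k : 'I_n].

(* The points are all the elements of [T]; [Ls] is the set of lines. *)
Definition is_projective_plane (n : nat) (T : finType) (Ls : {set {set T}})
    : Prop :=
  exists (A : {set T}) (L : 'I_n.+1 -> 'I_n -> {set T}) (Pinf : 'I_n.+1 -> T),
    [/\ is_affine_plane n A L,
        injective Pinf,
        [disjoint A & line_at_infinity Pinf],
        A :|: line_at_infinity Pinf = [set: T]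
      & Ls = projective_lines L Pinf].

Definition plane_isomorphic (T1 T2 : finType)
    (Ls1 : {set {set T1}}) (Ls2 : {set {set T2}}) : Prop :=
  exists2 f : T1 -> T2,
    bijective f & [set f @: (l : {set T1}) | l in Ls1] = Ls2.

(* Main.v *)
Require Import Defs.
From mathcomp Require Import all_boot.
From mathcomp Require Import ssralg zmodp.

(** In Hall coordinates, based on two points at infinity, an origin and a unit
    point, an affine plane of order n is a ternary operation [y = F k b x] with
    slope k and intercept b.  For k <> 0 the line [F k b] is a permutation of
    the n labels that starts with b; distinct lines with the same slope never
    agree, and lines with different slopes agree exactly once.  Hence the plane
    solves a finite constraint problem with n (n - 1) unknown permutations.
    Permuting the labels other than 0, 1, 2 normalizes the line of slope 2
    through the origin, which leaves a handful of cases; in each of them a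
    backtracking search that always branches on the unknown with the fewest
    remaining candidates is short.  It finds nothing for n = 6, and for n = 7
    only operations that become [k * x + b] over the field with 7 elements after
    a relabelling, so every projective plane of order 7 is the standard one. *)

Set Implicit Arguments.
Unset Strict Implicit.
Unset Printing Implicit Defensive.

(** * Complete backtracking search over finite domains *)

Lemma perm_map_preimage (T : eqType) (U : eqType) (f : T -> U) s t :
  perm_eq s (map f t) -> exists2 u, perm_eq u t & s = map f u.
Proof.
case: t => [|x0 t']; first by move/perm_nilP=> ->; exists [::].
move: (x0 :: t') => {}t /(perm_iotaP (f x0)) [r pr ->].
exists [seq nth x0 t i | i <- r].
  by apply/(perm_iotaP x0); exists r => //; rewrite -(size_map f).
rewrite -map_comp; apply/eq_in_map=> i ir /=; rewrite (nth_map x0) //.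
by have := perm_mem pr i; rewrite ir mem_iota size_map; case/esym/andP.
Qed.

Section Search.

Variables (T : eqType) (c : rel T).

Fixpoint pick_smallest (d : seq T) (n : nat) (seen ds : seq (seq T)) :=
  match ds with
  | [::] => (d, seen)
  | e :: ds' => let k := size e in
     if k < n then pick_smallest e k (d :: seen) ds'
     else pick_smallest d n (e :: seen) ds'
  end.

(** Every choice prunes the remaining domains; a domain that becomes empty is a smallest one, so it
    closes its branch at the next step. [fuel] bounds the number of choices. *)
Fixpoint search (fuel : nat) (chosen : seq T) (ds : seq (seq T)) :
    seq (seq T) :=
  match fuel, ds with
  | f.+1, d :: ds' =>
     let: (e, rest) := pick_smallest d (size d) [::] ds' in
     flatten
       [seq search f (t :: chosen) [seq [seq u <- d' | c t u] | d' <- rest]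
       | t <- e]
  | _, _ => [:: chosen]
  end.

Lemma perm_pick_smallest d n seen ds :
  let p := pick_smallest d n seen ds in perm_eq (p.1 :: p.2) (d :: seen ++ ds).
Proof.
elim: ds d n seen => [|e ds IH] d n seen /=; first by rewrite cats0.
case: ifP => _; apply: (perm_trans (IH _ _ _)) => /=.
  exact: (permEl (perm_catCA [:: e] (d :: seen) ds)).
by rewrite perm_cons; exact: (permEl (perm_catCA [:: e] seen ds)).
Qed.

(** [z] pairs each member of a hypothetical solution with its domain. The branch that takes the
    solution's own member of the picked domain never filters out another member, so it ends in that
    solution, up to the order of the choices. *)
Lemma search_complete fuel chosen (z : seq (T * seq T)) :
  size z <= fuel -> all (fun p => p.1 \in p.2) z -> uniq (unzip1 z) ->
  {in unzip1 z &, forall t u, t != u -> c t u} ->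
  exists2 s, s \in search fuel chosen (unzip2 z) &
    perm_eq s (unzip1 z ++ chosen).
Proof.
elim: fuel chosen z => [|f IH] chosen [|p z] //= sz zin zu zc;
  try by exists chosen => //; rewrite mem_seq1.
have := perm_pick_smallest p.2 (size p.2) [::] (unzip2 z).
case: (pick_smallest _ _ _ _) => e rest /=.
(* Picking a domain permutes the domains; the permutation is lifted to the pairs, so that each
   domain keeps its member of the solution. *)
rewrite -[p.2 :: _]/(map snd (p :: z)).
case/perm_map_preimage=> [[|q z'] // pz [-> ->]].
have {}zin : all (fun p => p.1 \in p.2) (q :: z') by rewrite (perm_all _ pz).
have pz1 : perm_eq (q.1 :: unzip1 z') (p.1 :: unzip1 z) := perm_map fst pz.
have {zu} /= /andP[qz' z'u] : uniq (q.1 :: unzip1 z').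
  by rewrite (perm_uniq pz1).
have {}zc : {in q.1 :: unzip1 z' &, forall t u, t != u -> c t u}.
  by move=> t u; rewrite !(perm_mem pz1); apply: zc.
case/andP: zin => qin z'in.
have [] := IH (q.1 :: chosen) [seq (r.1, [seq u <- r.2 | c q.1 u]) | r <- z'].
- by have /= [zz'] := perm_size pz; rewrite size_map zz'.
- rewrite all_map; apply/allP=> r rz.
  rewrite /= mem_filter (allP z'in) // andbT.
  have r1z : r.1 \in unzip1 z' by apply: map_f.
  apply: zc; rewrite ?mem_head // ?inE ?r1z ?orbT //.
  by apply: contraNneq qz' => ->.
- by rewrite /unzip1 -map_comp.
- rewrite /unzip1 -map_comp => t u tz uz.
  by apply: zc; rewrite inE ?(tz, uz) orbT.
rewrite /unzip2 -map_comp /unzip1 -map_comp => s s_in s_perm.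
exists s; last first.
  apply: (perm_trans s_perm).
  rewrite -cat_cons -(permPr (perm_cat pz1 (perm_refl chosen))) perm_sym.
  exact: (permEl (perm_catCA [:: q.1] (map fst z') chosen)).
apply/flattenP.
exists (search f (q.1 :: chosen)
          [seq [seq u <- d' | c q.1 u] | d' <- map snd z']); first exact: map_f.
by rewrite -map_comp.
Qed.

End Search.

(** * Lines as lists of values, and the constraint problem *)

Fixpoint disagree (t u : seq nat) : bool :=
  match t, u with
  | x :: t', y :: u' => if eqn x y then false else disagree t' u'
  | _, _ => true
  end.

Fixpoint agree_once (t u : seq nat) : bool :=
  match t, u with
  | x :: t', y :: u' => if eqn x y then disagree t' u' else agree_once t' u'
  | _, _ => false
  end.

Definition compat (t u : nat * seq nat) : bool :=
  if eqn t.1 u.1 then disagree t.2 u.2 else agree_once t.2 u.2.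

Lemma disagree_map (X : eqType) (f g : X -> nat) s :
  {in s, forall x, f x != g x} -> disagree (map f s) (map g s).
Proof.
elim: s => //= x s IH fg; rewrite eqnE (negPf (fg x (mem_head _ _))).
by apply: IH => y ys; apply: fg; rewrite inE ys orbT.
Qed.

Lemma agree_once_map (X : eqType) (f g : X -> nat) s x0 :
  uniq s -> x0 \in s -> {in s, forall x, (f x == g x) = (x == x0)} ->
  agree_once (map f s) (map g s).
Proof.
elim: s => //= x s IH /andP[xs us]; rewrite inE eqnE => x0s fg.
rewrite fg ?mem_head //; case: (eqVneq x x0) x0s fg => [<- _ fg | nx /= x0s fg].
  apply: disagree_map => y ys; rewrite fg ?inE ?ys ?orbT //.
  by apply: contraNneq xs => <-.
by apply: IH => // y ys; apply: fg; rewrite inE ys orbT.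
Qed.

(* Candidates for the line of slope [k] and intercept [b], where [g] is the
   prescribed line of slope 2 through the origin; the choice of the unit point
   makes slope 1 the identity and makes the line of slope [k] through the origin
   send 1 to [k]. *)
Definition domain (n : nat) (g : seq nat) (kb : nat * nat) :
    seq (nat * seq nat) :=
  let: (k, b) := kb in
  [seq (k, t) | t <-
    if eqn b 0 then
      if eqn k 1 then [:: iota 0 n] else
      if eqn k 2 then [:: g] else
      [seq 0 :: k :: u | u <- permutations [seq y <- iota 1 n.-1 | ~~ eqn y k]]
    else [seq b :: u | u <- permutations [seq y <- iota 0 n | ~~ eqn y b]]].

Definition line_indices n := [seq (k, b) | k <- iota 1 n.-1, b <- iota 0 n].

(** The fuel is the number of unknown lines. *)
Definition solutions n g :=
  search compat (n.-1 * n) [::] [seq domain n g kb | kb <- line_indices n].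

(** * Ternary rings and their lines *)

Definition ord_one n : 'I_n.+2 := lift ord0 ord0.

(** A form of Hall's planar ternary ring that constrains only the nonzero slopes. The last two
    fields record the choice of the unit point: the diagonal has slope 1, and a slope is the
    ordinate at abscissa 1 of the line through the origin. *)
Record ternary_ring n (F : 'I_n.+2 -> 'I_n.+2 -> 'I_n.+2 -> 'I_n.+2) : Prop :=
  TernaryRing {
    ternary_at0 : forall k b, k != ord0 -> F k b ord0 = b;
    ternary_inj : forall k b, k != ord0 -> injective (F k b);
    ternary_par : forall k b b' x, k != ord0 -> F k b x = F k b' x -> b = b';
    ternary_meet : forall k b k' b', k != ord0 -> k' != ord0 -> k != k' ->
      exists x0, forall x, (F k b x == F k' b' x) = (x == x0);
    ternary_diag : forall x, F (ord_one n) ord0 x = x;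
    ternary_at1 : forall k, k != ord0 -> F k ord0 (ord_one n) = k
  }.

(** The axioms name no labels besides 0 and 1, so they are invariant under conjugation by a
    permutation that fixes both. *)
Lemma ternary_ring_relabel n F (r r' : 'I_n.+2 -> 'I_n.+2) :
  cancel r r' -> cancel r' r -> r ord0 = ord0 -> r (ord_one n) = ord_one n ->
  ternary_ring F ->
  ternary_ring (fun k b x => r (F (r' k) (r' b) (r' x))).
Proof.
move=> rK r'K r0 r1 [F0 Finj Fpar Fmeet Fdiag F1].
have r'0 : r' ord0 = ord0 by rewrite -[in LHS]r0 rK.
have r'1 : r' (ord_one n) = ord_one n by rewrite -[in LHS]r1 rK.
have rn0 k : k != ord0 -> r' k != ord0.
  by apply: contraNneq => r'k; rewrite -(r'K k) r'k r0.
have rI := can_inj rK; have r'I := can_inj r'K.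
split=> [k b k0 | k b k0 x y | k b b' x k0 | k b k' b' k0 k'0 kk' | x | k k0].
- by rewrite r'0 F0 ?rn0 // r'K.
- by move=> /rI /(Finj _ _ (rn0 _ k0)) /r'I.
- by move=> /rI /(Fpar _ _ _ _ (rn0 _ k0)) /r'I.
- have [|x0 Fx0] := Fmeet (r' k) (r' b) (r' k') (r' b') (rn0 _ k0) (rn0 _ k'0).
    by rewrite (inj_eq r'I).
  by exists (r x0) => x; rewrite (inj_eq rI) Fx0 -(inj_eq rI) r'K.
- by rewrite r'1 r'0 Fdiag r'K.
- by rewrite r'0 r'1 F1 ?rn0 // r'K.
Qed.

Lemma permutations_behead (b : nat) s t :
  uniq t -> perm_eq (b :: s) t -> s \in permutations [seq y <- t | ~~ eqn y b].
Proof.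
move=> ut bst; rewrite mem_permutations.
have /andP[bs us] : uniq (b :: s) by rewrite (perm_uniq bst).
apply: uniq_perm => // [|y]; first exact: filter_uniq.
rewrite mem_filter -(perm_mem bst) inE eqnE.
by case: eqVneq => [->|] //=; rewrite (negPf bs).
Qed.

Section TernaryLines.

Variables (n : nat) (F : 'I_n.+2 -> 'I_n.+2 -> 'I_n.+2 -> 'I_n.+2).
Hypothesis tF : ternary_ring F.

Definition ternary_line (k b : 'I_n.+2) : seq nat :=
  [seq val (F k b x) | x <- enum 'I_n.+2].

Definition tagged_line (kb : 'I_n.+2 * 'I_n.+2) : nat * seq nat :=
  (val kb.1, ternary_line kb.1 kb.2).

Lemma size_ternary_line k b : size (ternary_line k b) = n.+2.
Proof. by rewrite size_map size_enum_ord. Qed.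

Lemma nth_ternary_line k b (x : 'I_n.+2) : nth 0 (ternary_line k b) x = F k b x.
Proof. by rewrite (nth_map ord0) ?size_enum_ord // nth_ord_enum. Qed.

Lemma ternary_line_cons k b : k != ord0 ->
  ternary_line k b =
    val b :: [seq val (F k b (lift ord0 x)) | x <- enum 'I_n.+1].
Proof.
by move=> k0; rewrite /ternary_line enum_ordSl /= ternary_at0 // -map_comp.
Qed.

Lemma ternary_line0_cons k : k != ord0 -> ternary_line k ord0 =
  0 :: val k :: [seq val (F k ord0 (lift ord0 (lift ord0 x))) | x <- enum 'I_n].
Proof.
move=> k0; rewrite ternary_line_cons // enum_ordSl /= -[lift _ _]/(ord_one n).
by rewrite ternary_at1 // -map_comp.
Qed.

Lemma perm_ternary_line k b :
  k != ord0 -> perm_eq (ternary_line k b) (iota 0 n.+2).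
Proof.
move=> k0; rewrite -val_enum_ord /ternary_line (map_comp val); apply/perm_map.
have uFk : uniq (map (F k b) (enum 'I_n.+2)).
  by rewrite map_inj_uniq ?enum_uniq //; apply: ternary_inj.
apply: uniq_perm => //; first exact: enum_uniq.
by have [|| _] := @uniq_min_size _ _ (enum 'I_n.+2) uFk => [x||];
  rewrite ?mem_enum ?size_map.
Qed.

Lemma compat_tagged_line kb kb' : kb.1 != ord0 -> kb'.1 != ord0 -> kb != kb' ->
  compat (tagged_line kb) (tagged_line kb').
Proof.
case: kb kb' => [k b] [k' b'] /= k0 k'0.
rewrite /compat /= eqnE val_eqE xpair_eqE.
case: eqVneq => [<- /= bb' | kk' _].
  apply: disagree_map => x _; apply: contraNneq bb' => /val_inj.
  by move/(ternary_par tF k0)=> ->.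
have [x0 Fx0] := ternary_meet tF b b' k0 k'0 kk'.
apply: (@agree_once_map _ _ _ _ x0); rewrite ?enum_uniq ?mem_enum // => x _.
by rewrite /= val_eqE.
Qed.

Lemma ternary_line0_permutations k v : k != ord0 -> val k = v ->
  ternary_line k ord0 \in
    [seq [:: 0, v & u] | u <- permutations [seq y <- iota 1 n.+1 | ~~ eqn y v]].
Proof.
move=> k0 <-; have := perm_ternary_line ord0 k0.
rewrite ternary_line0_cons // => kP.
apply: (map_f (fun u => [:: 0, val k & u])).
by apply: (@permutations_behead _ _ (iota 1 n.+1));
  rewrite ?iota_uniq // -(perm_cons 0).
Qed.

Lemma tagged_line_domain k b : k != ord0 ->
  tagged_line (k, b) \in
    domain n.+2 (ternary_line (inord 2) ord0) (val k, val b).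
Proof.
move=> k0; apply: map_f; rewrite -[eqn _ 0]/(val b == val (@ord0 n.+1)) val_eqE.
rewrite -[eqn _ 1]/(val k == 1) -[eqn _ 2]/(val k == 2).
have := perm_ternary_line b k0.
case: eqVneq => [-> | b0] /=.
  case: eqVneq => [k1 | k1].
    have -> : k = ord_one n by apply: val_inj.
    rewrite mem_seq1 => _; apply/eqP; rewrite -[RHS](val_enum_ord n.+2).
    by apply: eq_map => x; rewrite ternary_diag.
  case: eqVneq => [k2 | k2].
    have -> : inord 2 = k by apply: val_inj; rewrite /= inordK -k2.
    by move=> _; apply: mem_head.
  by move=> _; apply: ternary_line0_permutations.
rewrite ternary_line_cons // => bP; apply: (map_f (cons (val b))).
by apply: (@permutations_behead _ _ (iota 0 n.+2)); rewrite ?iota_uniq.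
Qed.

(** The lines of an actual ternary ring solve the constraint problem, so by completeness of the
    search they appear together in one listed solution. *)
Lemma tagged_line_solution :
  exists2 s, s \in solutions n.+2 (ternary_line (inord 2) ord0) &
    forall k b, k != ord0 -> tagged_line (k, b) \in s.
Proof.
pose kbs := [seq (k, b) | k <- [seq lift ord0 k | k <- enum 'I_n.+1],
  b <- enum 'I_n.+2].
have kbsE : [seq (val kb.1, val kb.2) | kb <- kbs] = line_indices n.+2.
  rewrite /line_indices -[n.+2.-1]/n.+1 -(val_enum_ord n.+2) allpairs_mapr.
  have -> : iota 1 n.+1 =
      [seq val k | k <- [seq lift ord0 k | k <- enum 'I_n.+1]].
    by rewrite -[LHS]/(behead (iota 0 n.+2)) -val_enum_ord enum_ordSl.
  by rewrite allpairs_mapl map_allpairs.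
have kbs_mem kb : (kb \in kbs) = (kb.1 != ord0).
  case: kb => k b; apply/allpairsP/idP =>
    [[[k' b'] /= [/mapP[j _ ->] _ [-> _]]] // | /= k0].
  have [j kj|] := unliftP ord0 k; last by move=> k1; rewrite k1 eqxx in k0.
  by exists (k, b); rewrite kj /= mem_enum; split=> //; apply/map_f/mem_enum.
have kbs_uniq : uniq kbs.
  apply: allpairs_uniq => [||[k b] [k' b'] _ _ [-> ->] //].
    by rewrite map_inj_uniq ?enum_uniq //; apply: lift_inj.
  exact: enum_uniq.
pose z := [seq (tagged_line kb,
  domain n.+2 (ternary_line (inord 2) ord0) (val kb.1, val kb.2)) | kb <- kbs].
have z1 : unzip1 z = [seq tagged_line kb | kb <- kbs].
  by rewrite /unzip1 -map_comp.
have z2 : unzip2 z =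
    [seq domain n.+2 (ternary_line (inord 2) ord0) kb
    | kb <- line_indices n.+2].
  by rewrite -kbsE /unzip2 -!map_comp.
have [||||s] := @search_complete _ compat (n.+1 * n.+2) [::] z.
- by rewrite size_map size_allpairs size_map !size_enum_ord.
- apply/allP=> _ /mapP[[k b] kb ->]; apply: tagged_line_domain.
  by rewrite kbs_mem in kb.
- rewrite z1 map_inj_in_uniq // => -[k b] [k' b'].
  rewrite !kbs_mem /= => k0 k'0.
  case=> /val_inj kk'; rewrite -{}kk' in k'0 *.
  by rewrite !ternary_line_cons // => -[/val_inj <-].
- move=> t u; rewrite z1 => /mapP[kb kbP ->] /mapP[kb' kb'P ->] neq.
  rewrite !kbs_mem in kbP kb'P; apply: compat_tagged_line => //.
  by apply: contraNneq neq => ->.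
rewrite z1 z2 cats0 => s_in sP; exists s => // k b k0.
by rewrite (perm_mem sP) map_f // kbs_mem.
Qed.

End TernaryLines.

(** * Normalizing the line of slope 2 through the origin *)

(** With lists read as functions, [c] is the conjugate of [g] by the permutation [r]. *)
Definition relabels (n : nat) (g c r : seq nat) : bool :=
  [seq nth 0 c (nth 0 r x) | x <- iota 0 n] ==
  [seq nth 0 r (nth 0 g x) | x <- iota 0 n].

Definition relabelings (n : nat) : seq (seq nat) :=
  [seq [:: 0, 1, 2 & u] | u <- permutations (iota 3 (n - 3))].

(** The lists [g] are the derangements of 1, ..., n - 1 with 1 sent to 2, extended by 0 fixed. Every
    line of slope 2 through the origin is among them. *)
Definition covers_up_to_relabeling (n : nat) (cs : seq (seq nat)) : bool :=
  all (fun g => has (fun c =>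
         (size c == n) && has (relabels n g c) (relabelings n)) cs)
    [seq g <- [seq [:: 0, 2 & u]
              | u <- permutations [seq y <- iota 1 n.-1 | ~~ eqn y 2]]
    | agree_once (iota 0 n) g].

(* The relabelling fixes 2, so that it preserves the line of slope 2 through the
   origin. *)
Lemma ternary_ring_normalize n
    (F : 'I_n.+3 -> 'I_n.+3 -> 'I_n.+3 -> 'I_n.+3) cs :
  covers_up_to_relabeling n.+3 cs -> ternary_ring F ->
  exists2 r : 'I_n.+3 -> 'I_n.+3, r ord0 = ord0 /\ injective r &
  exists2 F',
    ternary_ring F' /\ (forall k b x, F' (r k) (r b) (r x) = r (F k b x)) &
    ternary_line F' (inord 2) ord0 \in cs.
Proof.
move=> cs_ok tF; pose two : 'I_n.+3 := inord 2.
have val2 : val two = 2 by rewrite /= inordK.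
have two0 : two != ord0 by rewrite -val_eqE val2.
have g_in := ternary_line0_permutations tF two0 val2.
have line10 : ternary_line F (ord_one _) ord0 = iota 0 n.+3.
  by rewrite -val_enum_ord; apply: eq_map => x; rewrite ternary_diag.
(* Slopes 1 and 2 differ, so this line meets the diagonal exactly once; hence it is one of the lists
   that [cs_ok] covers. *)
have : agree_once (iota 0 n.+3) (ternary_line F two ord0).
  rewrite -line10.
  have := @compat_tagged_line _ _ tF (ord_one _, ord0) (two, ord0) isT two0.
  rewrite /compat /tagged_line; case: eqVneq => [[] /(congr1 val) | _ /(_ isT)].
    by rewrite val2.
  by rewrite [X in eqn _ X]val2.
set g := ternary_line F two ord0 in g_in * => g1.
have /hasP[c c_in /andP[/eqP sc /hasP[rl]]] :
    has (fun c =>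
      (size c == n.+3) && has (relabels n.+3 g c) (relabelings n.+3)) cs.
  by apply: (allP cs_ok); rewrite mem_filter g1.
case/mapP=> u; rewrite mem_permutations => pu rlE /eqP rl_conj.
have rlP : perm_eq rl (iota 0 n.+3).
  by rewrite rlE !perm_cons; move: pu; rewrite subSS subSS subSS subn0.
have srl : size rl = n.+3 by rewrite (perm_size rlP) size_iota.
have rl_lt (x : 'I_n.+3) : nth 0 rl x < n.+3.
  have := @mem_nth _ 0 rl x.
  by rewrite srl (perm_mem rlP) mem_iota => /(_ (ltn_ord x)).
pose r (x : 'I_n.+3) := Ordinal (rl_lt x).
have rI : injective r.
  move=> x y /(congr1 val) /= /eqP.
  by rewrite nth_uniq ?srl ?(perm_uniq rlP) ?iota_uniq // => /eqP/val_inj.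
have [r' rK r'K] := injF_bij rI.
have r0 : r ord0 = ord0 by apply: val_inj; rewrite /= rlE.
have r1 : r (ord_one _) = ord_one _ by apply: val_inj; rewrite /= rlE.
have r2 : r two = two by apply: val_inj; rewrite /= val2 rlE.
exists r => //; exists (fun k b x => r (F (r' k) (r' b) (r' x))).
  by split=> [|k b x]; [exact: ternary_ring_relabel | rewrite !rK].
set F' := fun k b x => r _; suff -> : ternary_line F' (inord 2) ord0 = c by [].
apply: (@eq_from_nth _ 0) => [|i]; first by rewrite size_map size_enum_ord sc.
rewrite size_map size_enum_ord => lt_i.
rewrite (nth_map ord0) ?size_enum_ord // {}/F'.
have r'0 : r' ord0 = ord0 by rewrite -[in LHS]r0 rK.
have r'2 : r' two = two by rewrite -[in LHS]r2 rK.
(* The conjugacy equation at the label that [r] moves to [i] gives entry [i] of [c]. *)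
pose x := r' (Ordinal lt_i).
have -> : nth ord0 (enum 'I_n.+3) i = r x.
  by rewrite r'K -(nth_ord_enum ord0 (Ordinal lt_i)).
have -> : i = nth 0 rl x by rewrite -[RHS]/(val (r x)) r'K.
rewrite -/two r'2 r'0 rK.
have /(congr1 (nth 0 ^~ x)) := rl_conj.
rewrite !(nth_map 0) ?size_iota // nth_iota // add0n => ->.
by rewrite /g nth_ternary_line.
Qed.

(** * Computations for orders 6 and 7 *)

(* One list for each way of labelling a derangement of 1, ..., n - 1 along its
   cycles, starting with the cycle (1 2 ...). *)
Definition first_lines6 :=
  [:: [:: 0; 2; 3; 4; 5; 1]; [:: 0; 2; 3; 1; 5; 4]; [:: 0; 2; 1; 4; 5; 3]].

Definition first_lines7 :=
  [:: [:: 0; 2; 3; 4; 5; 6; 1]; [:: 0; 2; 1; 4; 5; 6; 3];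
      [:: 0; 2; 3; 4; 1; 6; 5]; [:: 0; 2; 3; 1; 5; 6; 4];
      [:: 0; 2; 1; 4; 3; 6; 5]].

(** [head 0 kt.2] is the intercept, since a line of nonzero slope starts with its value at 0. *)
Definition linearizes (s : seq nat) (kt : nat * seq nat) : bool :=
  [seq nth 0 s y | y <- kt.2] ==
  [seq (nth 0 s kt.1 * nth 0 s x + nth 0 s (head 0 kt.2)) %% 7 | x <- iota 0 7].

(** A single relabelling must serve all lines at once; it is sought among those that keep 0 and 1 as
    the zero and the unit of the field. *)
Definition linearizable (sol : seq (nat * seq nat)) : bool :=
  has (fun s => all (linearizes s) sol)
    [seq [:: 0, 1 & u] | u <- permutations (iota 2 5)].

Lemma first_lines6_cover : covers_up_to_relabeling 6 first_lines6.
Proof. by vm_compute. Qed.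

Lemma first_lines7_cover : covers_up_to_relabeling 7 first_lines7.
Proof. by vm_compute. Qed.

Lemma solutions6 : all (fun g => nilp (solutions 6 g)) first_lines6.
Proof. by vm_compute. Qed.

Lemma solutions7 : all (fun g => all linearizable (solutions 7 g)) first_lines7.
Proof. by vm_compute. Qed.

Lemma no_ternary_ring6 (F : 'I_6 -> 'I_6 -> 'I_6 -> 'I_6) : ~ ternary_ring F.
Proof.
case/(ternary_ring_normalize first_lines6_cover)=> r _ [F' [tF' _]].
move/(allP solutions6).
by have [s] := tagged_line_solution tF'; case: (solutions _ _).
Qed.

(** [s] is the normalizing relabelling followed by the list that linearizes the solution found by
    the search. *)
Lemma ternary_ring7_linear (F : 'I_7 -> 'I_7 -> 'I_7 -> 'I_7) :
  ternary_ring F ->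
  exists2 s : 'I_7 -> nat, [/\ s ord0 = 0, injective s & forall x, s x < 7] &
    forall k b x, k != ord0 -> s (F k b x) = (s k * s x + s b) %% 7.
Proof.
case/(ternary_ring_normalize first_lines7_cover)=> r [r0 rI] [F' [tF' F'E]].
move/(allP solutions7)=> all_sols.
have [sol /(allP all_sols) /hasP[s s_in /allP s_lin] solP] :=
  tagged_line_solution tF'.
case/mapP: s_in {all_sols} => u; rewrite mem_permutations => pu sE.
have sP : perm_eq s (iota 0 7) by rewrite sE !perm_cons.
have ss : size s = 7 by rewrite (perm_size sP).
exists (fun x => nth 0 s (r x)); first split.
- by rewrite r0 sE.
- move=> x y /eqP; rewrite nth_uniq ?ss //; first by move/eqP/val_inj/rI.
  by rewrite (perm_uniq sP).
- move=> x; have : nth 0 s (r x) \in s by rewrite mem_nth ?ss.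
  by rewrite (perm_mem sP) mem_iota.
move=> k b x k0; have rk0 : r k != ord0 by rewrite -r0 (inj_eq rI).
have /eqP/(congr1 (nth 0 ^~ (r x))) := s_lin _ (solP (r k) (r b) rk0).
rewrite -[(tagged_line _ _).1]/(val (r k)).
rewrite -[(tagged_line _ _).2]/(ternary_line F' (r k) (r b)).
rewrite (nth_map 0) ?size_ternary_line // nth_ternary_line F'E => ->.
by rewrite (nth_map 0) ?size_iota // nth_iota // ternary_line_cons.
Qed.

(** * Coordinates on affine planes *)

(** [h i p] stands for the index of the line of class [i] through [p]. Any two classes then give a
    bijection from [A] to pairs of indices: an orthogonal array of strength two and index one. *)
Definition class_coordinates n (T : finType) (A : {set T})
    (h : 'I_n.+1 -> T -> 'I_n) : Prop :=
  forall i j k m, i != j ->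
  exists2 p, p \in A &
    {in A, forall q, (h i q == k) && (h j q == m) = (q == p)}.

Lemma class_coordinates_inj n (T : finType) (A : {set T})
    (h : 'I_n.+1 -> T -> 'I_n) i j :
  class_coordinates A h -> i != j ->
  {in A &, forall p q, h i p = h i q -> h j p = h j q -> p = q}.
Proof.
move=> hA ij p q pA qA hi hj; have [r _ rP] := hA i j (h i p) (h j p) ij.
have := rP p pA; have := rP q qA.
by rewrite hi hj !eqxx => /esym/eqP -> /esym/eqP.
Qed.

(** The disjoint lines of one class have as many points together as [A], so they partition [A] and
    each point has an index in each class. *)
Lemma affine_plane_coordinates n (T : finType) (A : {set T}) L :
  is_affine_plane n.+1 A L ->
  exists2 h, class_coordinates A h &
    forall i k, L i k = [set p in A | h i p == k].
Proof.
case=> cardA subL cardL _ disjL meetL.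
have cover_class i : A = \bigcup_k L i k.
  apply/esym/eqP; rewrite eqEcard; apply/andP; split; first exact/bigcupsP.
  rewrite -[leqRHS]sum1_card partition_disjoint_bigcup; last exact: disjL.
  under eq_bigr do rewrite sum1_card cardL.
  by rewrite sum_nat_const card_ord cardA mulnn.
(* The default is reached only by points outside [A]. *)
pose h i p := odflt ord0 [pick k | p \in L i k].
have hP i p k : p \in A -> (p \in L i k) = (h i p == k).
  rewrite {1}(cover_class i) => /bigcupP[m _ pm].
  have uniq_line l : p \in L i l -> l = m.
    by move=> pl; apply/eqP/idPn=> /(disjL i) /disjointFr/(_ pl); rewrite pm.
  rewrite /h; case: pickP => [l pl | /(_ m)]; last by rewrite pm.
  by rewrite (uniq_line _ pl) /=; apply/idP/eqP => [/uniq_line | <-].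
have LE i k : L i k = [set p in A | h i p == k].
  apply/setP=> p; rewrite inE.
  have [pA | pA] := boolP (p \in A); first by rewrite hP.
  by apply/contraNF: pA; apply/subsetP.
exists h => // i j k m ij; have /eqP/cards1P[p pE] := meetL i j k m ij.
have /setIP[pi _] : p \in L i k :&: L j m by rewrite pE set11.
exists p => [|q qA]; first exact: subsetP pi.
by rewrite -(in_set1 q p) -pE inE !hP.
Qed.

(** Injectivity suffices by counting: [A] has as many points as there are pairs of indices. A second
    class [j] then counts the points of a line of class [i]. *)
Lemma class_coordinates_affine_plane n (T : finType) (A : {set T})
    (h : 'I_n.+2 -> T -> 'I_n.+1) :
  #|A| = n.+1 ^ 2 ->
  (forall i j, i != j -> {in A &, injective (fun p => (h i p, h j p))}) ->
  class_coordinates A h /\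
  is_affine_plane n.+1 A (fun i k => [set p in A | h i p == k]).
Proof.
move=> cardA hI.
have hA : class_coordinates A h.
  move=> i j k m ij.
  have : (k, m) \in [set (h i p, h j p) | p in A].
    suff -> : [set (h i p, h j p) | p in A] = setT by rewrite inE.
    apply/eqP; rewrite eqEcard subsetT cardsT card_prod !card_ord.
    by rewrite card_in_imset ?cardA ?mulnn ?leqnn //; exact: hI ij.
  case/imsetP=> p pA [-> ->]; exists p => // q qA.
  apply/andP/eqP => [[/eqP hi /eqP hj] | -> //].
  by apply: (hI i j ij) => //; rewrite hi hj.
have card_line i k : #|[set p in A | h i p == k]| = n.+1.
  have [j ij] : exists j, i != j.
    by exists (if i == ord0 then ord_one n else ord0); case: ifPn => // /eqP ->.
  rewrite -[RHS]card_ord -cardsT -(@card_in_imset _ _ (h j)) => [|p q].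
    apply: eq_card => m; rewrite inE; apply/imsetP.
    have [p pA pP] := hA i j k m ij; exists p; rewrite ?inE ?pA //=.
      by have := pP p pA; rewrite eqxx => /andP[].
    by have := pP p pA; rewrite eqxx => /andP[_ /eqP].
  rewrite !inE => /andP[pA /eqP hp] /andP[qA /eqP hq] hj.
  exact: (class_coordinates_inj hA ij pA qA (etrans hp (esym hq)) hj).
split=> //; split=> // [i k | i k m km | i k m km | i j k m ij].
- by apply/subsetP=> p; rewrite inE => /andP[].
- have /card_gt0P[p] : 0 < #|[set p in A | h i p == k]| by rewrite card_line.
  move=> pk; have := pk; rewrite km; move: pk.
  by rewrite !inE => /andP[_ /eqP <-] /andP[_ /eqP].
- rewrite -setI_eq0; apply/eqP/setP=> p; rewrite !inE.
  by apply: contraNF km => /andP[/andP[_ /eqP <-] /andP[_ /eqP <-]].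
- have [p pA pP] := hA i j k m ij; apply/eqP/cards1P; exists p; apply/setP=> q.
  rewrite !inE; have [qA | qA] := boolP (q \in A); first by rewrite -pP.
  by apply/esym/negbTE; apply: contraNneq qA => ->.
Qed.

(* The point [p] has abscissa [h ord0 p] and ordinate [Y (h (ord_one _) p)]. *)
Lemma class_coordinates_ternary n (T : finType) (A : {set T})
    (h : 'I_n.+3 -> T -> 'I_n.+2) :
  class_coordinates A h ->
  exists F Y (slope : 'I_n.+1 -> 'I_n.+2)
      (icpt : 'I_n.+1 -> 'I_n.+2 -> 'I_n.+2),
  [/\ ternary_ring F, injective Y, injective slope, forall j, slope j != ord0 &
      forall j p, p \in A ->
        Y (h (ord_one _) p) =
          F (slope j) (icpt j (h (lift ord0 (lift ord0 j)) p)) (h ord0 p)].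
Proof.
move=> hA; pose col : 'I_n.+3 := ord0; pose row : 'I_n.+3 := ord_one _.
pose other (j : 'I_n.+1) : 'I_n.+3 := lift ord0 (lift ord0 j).
have hI i j : i != j ->
    {in A &, forall p q, h i p = h i q -> h j p = h j q -> p = q}.
  exact: class_coordinates_inj.
(* Stated as a sigma type, so that intersection points can be used to define functions. *)
have meet i j k m : i != j -> {p | p \in A & h i p = k /\ h j p = m}.
  move=> ij; have : exists p, [&& p \in A, h i p == k & h j p == m].
    by have [p pA pP] := hA i j k m ij; exists p; rewrite pA pP ?eqxx.
  by case/sigW=> p /and3P[? /eqP ? /eqP ?]; exists p.
have other_col j : col != other j by [].
have other_row j : row != other j by [].
have other_inj : injective other by move=> j j' /lift_inj /lift_inj.
have [O OA [Oc Or]] := meet col row ord0 ord0 isT.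
(* the diagonal through [O] identifies row labels with column labels *)
pose diag y := s2val (meet col (other ord0) y (h (other ord0) O) isT).
have diagA y : diag y \in A by rewrite /diag; case: (meet _ _ _ _ _).
have diag_col y : h col (diag y) = y.
  by rewrite /diag; case: (meet _ _ _ _ _) => ? ? [].
have diag_d y : h (other ord0) (diag y) = h (other ord0) O.
  by rewrite /diag; case: (meet _ _ _ _ _) => ? ? [].
have diagO : diag ord0 = O.
  by apply: (hI col (other ord0)); rewrite ?diag_col ?diag_d.
have diag_row_inj : injective (fun y => h row (diag y)).
  move=> y y' yy'; rewrite -(diag_col y) -(diag_col y'); congr (h col _).
  by apply: (hI row (other ord0)); rewrite ?diag_d.
have [Y YK KY] := injF_bij diag_row_inj.
have YI : injective Y := can_inj KY.
pose y p := Y (h row p).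
have yO : y O = ord0 by rewrite /y -diagO YK.
have colyI : {in A &, forall p q, h col p = h col q -> y p = y q -> p = q}.
  by move=> p q pA qA pq /YI; apply: (hI col row).
(* The point of abscissa [x] on line [k] of the class [other j]. *)
pose on j k x := s2val (meet col (other j) x k isT).
have onA j k x : on j k x \in A by rewrite /on; case: (meet _ _ _ _ _).
have on_col j k x : h col (on j k x) = x.
  by rewrite /on; case: (meet _ _ _ _ _) => ? ? [].
have on_j j k x : h (other j) (on j k x) = k.
  by rewrite /on; case: (meet _ _ _ _ _) => ? ? [].
have onE j k x p : p \in A -> h col p = x -> h (other j) p = k -> on j k x = p.
  by move=> pA pc pj; apply: (hI col (other j)); rewrite ?on_col ?on_j.
pose slope j := y (on j (h (other j) O) (ord_one n)).
have slopeO j p : p \in A -> h (other j) p = h (other j) O -> p != O ->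
    y p != ord0.
  move=> pA pj; apply: contraNneq; rewrite -yO => /YI pO.
  by apply/eqP; apply: (hI row (other j)).
have onO j k : on j k (ord_one n) != O.
  by apply/eqP=> /(congr1 (h col)); rewrite on_col Oc.
have slope0 j : slope j != ord0 by apply: (slopeO j); rewrite ?on_j.
have slope_inj : injective slope.
  move=> i j ij; apply/eqP/idPn=> nij.
  have e : on i (h (other i) O) (ord_one n) = on j (h (other j) O) (ord_one n).
    by apply: colyI (onA _ _ _) (onA _ _ _) _ ij; rewrite !on_col.
  case/eqP: (onO i (h (other i) O)).
  by apply: (hI (other i) (other j)); rewrite ?on_j // e on_j.
(* The slopes inject the classes [other j] into equally many nonzero labels, so they can be inverted
   by [cls]. The default in [cls] concerns slope 0 only, which the axioms leave free. *)
have slope_lift j : {j' | slope j = lift ord0 j'}.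
  have [j' ->|/eqP] := unliftP ord0 (slope j); first by exists j'.
  by rewrite (negPf (slope0 j)).
pose sl (j : 'I_n.+1) : 'I_n.+1 := sval (slope_lift j).
have slE j : slope j = lift ord0 (sl j) := svalP (slope_lift j).
have sl_inj : injective sl by move=> i j ij; apply: slope_inj; rewrite !slE ij.
have [sl' slK slK'] := injF_bij sl_inj.
pose cls k := sl' (odflt ord0 (unlift ord0 k)).
have slopeK : cancel slope cls.
  by move=> j; rewrite /cls slE liftK /= slK.
have clsK k : k != ord0 -> slope (cls k) = k.
  rewrite /cls; have [j ->|->] := unliftP ord0 k; last by rewrite eqxx.
  by move=> _; rewrite /= slE slK'.
have P x b : {p | p \in A & h col p = x /\ y p = b}.
  have [p pA [pc pr]] := meet col row x (h row (diag b)) isT.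
  by exists p; rewrite // /y pr YK.
(* The index of the line of class [other j] that crosses the axis of abscissa 0 at height [b], that
   is, the line with intercept [b]. *)
pose base j b := h (other j) (s2val (P ord0 b)).
have baseE j b p : p \in A -> h col p = ord0 -> y p = b ->
    h (other j) p = base j b.
  rewrite /base; case: (P _ _) => q qA [qc qb] pA pc pb /=; congr (h _ _).
  by apply: colyI; rewrite ?qc ?qb.
have baseO j : base j ord0 = h (other j) O by rewrite -(baseE j ord0 O).
have baseI j : injective (base j).
  move=> b b'; rewrite /base.
  case: (P _ b) (P _ b') => p pA [pc yp] [p' p'A [p'c yp']] /= pp'.
  by rewrite -yp -yp'; congr y; apply: (hI col (other j)); rewrite ?pc.
pose F k b x := y (on (cls k) (base (cls k) b) x).
exists F, Y, slope, (fun j k => y (on j k ord0)); split=> //; last first.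
  move=> j p pA; rewrite /F slopeK -/(y p); congr y; symmetry; apply: onE => //.
  by rewrite -(baseE _ _ (on j (h (other j) p) ord0)).
split=> [k b k0 | k b k0 x x' | k b b' x k0 | k b k' b' k0 k'0 kk' | x | k k0].
- rewrite /F; case: (P ord0 b) => p pA [pc pb]; rewrite -(baseE _ _ p) //.
  by rewrite (@onE _ _ _ p).
- rewrite /F => /YI xx'; rewrite -(on_col (cls k) (base (cls k) b) x).
  rewrite -[RHS](on_col (cls k) (base (cls k) b) x'); congr (h col _).
  by apply: (hI row (other (cls k))); rewrite ?on_j.
- rewrite /F => yy; apply: (baseI (cls k)).
  rewrite -(on_j (cls k) (base (cls k) b) x).
  rewrite -[RHS](on_j (cls k) (base (cls k) b') x).
  by congr (h _ _); apply: colyI; rewrite ?on_col.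
- have jj' : other (cls k) != other (cls k').
    rewrite (inj_eq other_inj); apply: contraNneq kk' => e.
    by rewrite -(clsK k) // e clsK.
  have [p pA [pj pj']] := meet _ _ (base (cls k) b) (base (cls k') b') jj'.
  exists (h col p) => x; apply/eqP/eqP => [yy | ->]; last first.
    by rewrite /F !(@onE _ _ _ p).
  have e : on (cls k) (base (cls k) b) x = on (cls k') (base (cls k') b') x.
    by apply: colyI (onA _ _ _) (onA _ _ _) _ yy; rewrite !on_col.
  rewrite -(on_col (cls k) (base (cls k) b) x); congr (h col _).
  by apply: (hI _ _ jj'); rewrite ?on_j // e on_j.
(* The row labels were read off the line of class [other ord0] through [O], so that line has slope 1
   and is the diagonal. *)
- have sl0 : slope ord0 = ord_one n.
    by rewrite /slope (@onE _ _ _ (diag (ord_one n))) // /y YK.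
  by rewrite /F -sl0 slopeK baseO (@onE _ _ _ (diag x)) // /y YK.
- by rewrite /F baseO -[RHS]clsK.
Qed.

(** * Isomorphisms of projective planes *)

Lemma plane_isomorphic_sym (T1 T2 : finType)
    (Ls1 : {set {set T1}}) (Ls2 : {set {set T2}}) :
  plane_isomorphic Ls1 Ls2 -> plane_isomorphic Ls2 Ls1.
Proof.
case=> f [g fK gK] <-; exists g; first by exists f.
rewrite -imset_comp -[RHS]imset_id; apply: eq_imset => l /=.
by rewrite -imset_comp -[RHS]imset_id; apply: eq_imset => p /=; apply: fK.
Qed.

Lemma plane_isomorphic_trans (T1 T2 T3 : finType) (Ls1 : {set {set T1}})
    (Ls2 : {set {set T2}}) (Ls3 : {set {set T3}}) :
  plane_isomorphic Ls1 Ls2 -> plane_isomorphic Ls2 Ls3 ->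
  plane_isomorphic Ls1 Ls3.
Proof.
case=> f f_bij <- [g g_bij <-]; exists (g \o f); first exact: bij_comp.
by rewrite -imset_comp; apply: eq_imset => l /=; apply: imset_comp.
Qed.

Lemma projective_plane_card n (T : finType) (A : {set T}) L (P : 'I_n.+1 -> T) :
  is_affine_plane n A L -> injective P -> [disjoint A & line_at_infinity P] ->
  A :|: line_at_infinity P = setT -> #|T| = n ^ 2 + n.+1.
Proof.
case=> cardA _ _ _ _ _ PI AP APT.
rewrite -cardsT -APT cardsU disjoint_setI0 // cards0 subn0 cardA.
by rewrite card_imset // card_ord.
Qed.

(** An affine map that respects the classes extends to infinity by its action [kappa] on the
    classes. Injectivity in one direction is enough, since both planes have the same number of
    points and of lines in each class. *)
Lemma affine_map_plane_isomorphic n (T1 T2 : finType)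
    (A1 : {set T1}) (A2 : {set T2}) L1 L2
    (P1 : 'I_n.+1 -> T1) (P2 : 'I_n.+1 -> T2)
    (phi : T1 -> T2) (kappa : 'I_n.+1 -> 'I_n.+1) :
  is_affine_plane n A1 L1 -> is_affine_plane n A2 L2 ->
  injective P1 -> injective P2 ->
  [disjoint A1 & line_at_infinity P1] -> [disjoint A2 & line_at_infinity P2] ->
  A1 :|: line_at_infinity P1 = setT -> A2 :|: line_at_infinity P2 = setT ->
  {in A1 &, injective phi} -> {in A1, forall p, phi p \in A2} ->
  injective kappa ->
  (forall i k, exists m, phi @: L1 i k = L2 (kappa i) m) ->
  plane_isomorphic (projective_lines L1 P1) (projective_lines L2 P2).
Proof.
move=> aff1 aff2 P1I P2I AP1 AP2 APT1 APT2 phiI phiA kappaI phiL.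
pose f p :=
  if p \in A1 then phi p else P2 (kappa (odflt ord0 [pick i | P1 i == p])).
have notA (T : finType) (A : {set T}) (P : 'I_n.+1 -> T) i :
    [disjoint A & line_at_infinity P] -> P i \notin A.
  by move=> AP; rewrite (disjointFl AP) // imset_f.
have fP i : f (P1 i) = P2 (kappa i).
  rewrite /f (negPf (notA _ _ _ i AP1)).
  case: pickP => [j /eqP/P1I -> // | /(_ i)].
  by rewrite eqxx.
have fA p : p \in A1 -> f p = phi p by rewrite /f => ->.
have ptP p : p \in A1 \/ exists i, p = P1 i.
  have : p \in A1 :|: line_at_infinity P1 by rewrite APT1.
  by case/setUP=> [|/imsetP[i _]]; [left | right; exists i].
have fI : injective f.
  have neq p i : p \in A1 -> f p <> f (P1 i).
    move=> pA; rewrite fP fA // => e.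
    by have := notA _ _ _ (kappa i) AP2; rewrite -e phiA.
  move=> p q; have [pA | [i ->]] := ptP p; have [qA | [j ->]] := ptP q.
  - by rewrite !fA //; apply: phiI.
  - by move/(neq p j pA).
  - by move/esym/(neq q i qA).
  - by rewrite !fP => /P2I/kappaI ->.
have card12 : #|T2| <= #|T1|.
  rewrite (projective_plane_card aff1 P1I) //.
  by rewrite (projective_plane_card aff2 P2I).
have [kappa' kappaK kappa'K] := injF_bij kappaI.
exists f; first exact: inj_card_bij.
have f_inf : f @: line_at_infinity P1 = line_at_infinity P2.
  rewrite /line_at_infinity -imset_comp (eq_imset _ fP); apply/setP=> p.
  apply/imsetP/imsetP => [[i _ ->] | [i _ ->]]; first by exists (kappa i).
  by exists (kappa' i) => //; rewrite kappa'K.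
have fL i k : f @: (P1 i |: L1 i k) = P2 (kappa i) |: phi @: L1 i k.
  rewrite imsetU1 fP; congr (_ |: _); apply: eq_in_imset => p.
  by move/(subsetP (affine_line_sub aff1 i k)); apply: fA.
have line_inj i k k' : phi @: L1 i k = phi @: L1 i k' -> k = k'.
  move=> e; apply: (affine_line_inj aff1 (i := i)).
  have sub k1 k2 : phi @: L1 i k1 = phi @: L1 i k2 -> L1 i k1 \subset L1 i k2.
    move=> e12; apply/subsetP=> p pk.
    have pA := subsetP (affine_line_sub aff1 i k1) p pk.
    have : phi p \in phi @: L1 i k2 by rewrite -e12 imset_f.
    case/imsetP=> q qk /phiI -> //.
    exact: subsetP (affine_line_sub aff1 i k2) q qk.
  by apply/eqP; rewrite eqEsubset !sub.
have line_surj i m : exists k, phi @: L1 (kappa' i) k = L2 i m.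
  have ex k : exists m', phi @: L1 (kappa' i) k == L2 i m'.
    by have [m' ->] := phiL (kappa' i) k; exists m'; rewrite kappa'K.
  (* [mu] is an injective self-map of the line indices of a class, hence surjective: every line of
     the target class is an image. *)
  pose mu k := xchoose (ex k).
  have muE k : phi @: L1 (kappa' i) k = L2 i (mu k) := eqP (xchooseP (ex k)).
  have muI : injective mu.
    by move=> k k' e; apply: (@line_inj (kappa' i)); rewrite !muE e.
  by have [mu' _ mu'K] := injF_bij muI; exists (mu' m); rewrite muE mu'K.
rewrite /projective_lines imsetU1 f_inf; congr (_ |: _); apply/setP=> l.
apply/imsetP/imset2P => [[_ /imset2P[i k _ _ ->] ->] | [i m _ _ ->]].
  by have [m e] := phiL i k; exists (kappa i) m; rewrite // fL e.
have [k e] := line_surj i m; exists (P1 (kappa' i) |: L1 (kappa' i) k).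
  exact: imset2_f.
by rewrite fL e kappa'K.
Qed.

(** * The plane over the field with 7 elements, and uniqueness *)

Section StandardPlane7.

Import GRing.Theory.
Local Open Scope ring_scope.

Definition point7 : finType := ('F_7 * 'F_7 + 'I_8)%type.

(* The class [ord0] consists of the lines [x = k], and the class [lift ord0 a]
   of the lines [y = a * x + k]. *)
Definition class7 (i : 'I_8) (p : point7) : 'I_7 :=
  match p with
  | inl (x, y) => if unlift ord0 i is Some a then y - (a : 'F_7) * x else x
  | inr _ => ord0
  end.

Definition affine7 : {set point7} := [set inl c | c : 'F_7 * 'F_7].

Definition lines7 (i : 'I_8) (k : 'I_7) : {set point7} :=
  [set p in affine7 | class7 i p == k].

Definition infinity7 (i : 'I_8) : point7 := inr i.

Lemma is_affine_plane7 : is_affine_plane 7 affine7 lines7.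
Proof.
apply: (proj2 (class_coordinates_affine_plane _ _)).
  by rewrite card_imset ?card_prod ?card_Fp // => ? ? [].
move=> i j ij _ _ /imsetP[[x y] _ ->] /imsetP[[x' y'] _ ->] [].
move: ij; rewrite /class7.
have [a ->|->] := unliftP ord0 i; have [b ->|->] := unliftP ord0 j => //=.
- rewrite (inj_eq lift_inj) => ab ea eb.
  (* Eliminating the ordinates leaves [(b - a) * x = (b - a) * x']. *)
  have := congr2 (fun u v => - v + u) ea eb; rewrite !opprB !subrKA -!mulrBl.
  have ba0 : (b : 'F_7) - (a : 'F_7) != 0 by rewrite subr_eq0 eq_sym.
  by move/(mulfI ba0) => xx'; move: ea; rewrite xx' => /addIr ->.
- by move=> _ e xx'; move: e; rewrite xx' => /addIr ->.
- by move=> _ -> /addIr ->.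
Qed.

Lemma infinity7_inj : injective infinity7.
Proof. by move=> i j []. Qed.

Lemma disjoint_affine7 : [disjoint affine7 & line_at_infinity infinity7].
Proof.
rewrite -setI_eq0; apply/eqP/setP=> p; rewrite !inE.
by apply/andP=> -[/imsetP[c _ ->] /imsetP[]].
Qed.

Lemma affine7U_infinity7 : affine7 :|: line_at_infinity infinity7 = setT.
Proof. by apply/setP=> -[c|i]; rewrite !inE imset_f ?orbT. Qed.

(** In the linearized coordinates the lines of every class satisfy linear equations over ['F_7], so
    sending a point to its coordinates maps lines to standard lines. *)
Lemma projective_plane7_standard (T : finType) (Ls : {set {set T}}) :
  is_projective_plane 7 Ls ->
  plane_isomorphic Ls (projective_lines lines7 infinity7).
Proof.
case=> A [L [P [aff PI AP APT ->]]].
have [h hA LE] := affine_plane_coordinates aff.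
have [F [Y [slope [icpt [tF YI slopeI slope0 hF]]]]] :=
  class_coordinates_ternary hA.
have [s [s0 sI s7] sF] := ternary_ring7_linear tF.
pose sg (x : 'I_7) : 'F_7 := (s x)%:R.
have sgI : injective sg.
  by move=> x y /(congr1 val) /=; rewrite !val_Fp_nat // !modn_small // => /sI.
have sgF k b x : k != ord0 -> sg (F k b x) = sg k * sg x + sg b.
  by move=> k0; rewrite /sg sF // Fp_nat_mod // natrD natrM.
pose phi p : point7 := inl (sg (h ord0 p), sg (Y (h (ord_one _) p))).
(* Columns go to the vertical class, rows to slope 0, and every other class to its linearized slope;
   [G] gives the index of the image line. *)
pose kappa (i : 'I_8) : 'I_8 :=
  if unlift ord0 i is Some i' then
    lift ord0 (if unlift ord0 i' is Some j then sg (slope j) else 0 : 'F_7)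
  else ord0.
pose G (i : 'I_8) (k : 'I_7) : 'I_7 :=
  if unlift ord0 i is Some i' then
    (if unlift ord0 i' is Some j then sg (icpt j k) else sg (Y k))
  else sg k.
have class_phi i p : p \in A -> class7 (kappa i) (phi p) = G i (h i p).
  move=> pA; rewrite /class7 /kappa /G /phi.
  have [i' ->|->] := unliftP ord0 i; last by rewrite unlift_none.
  rewrite liftK; have [j ->|->] := unliftP ord0 i'; last by rewrite mul0r subr0.
  by rewrite (hF j) // sgF // [_ + sg _]addrC addrK.
have phiA : {in A, forall p, phi p \in affine7} by move=> p _; apply: imset_f.
have phiI : {in A &, injective phi}.
  move=> p q pA qA [/sgI hc /sgI/YI hr].
  exact: (class_coordinates_inj hA (isT : ord0 != ord_one 6) pA qA).
have kappaI : injective kappa.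
  move=> i j; rewrite /kappa.
  (* Nonzero slopes stay nonzero, so no other class collides with the rows. *)
  have sg0 k : k != ord0 -> sg k != 0.
    by apply: contraNneq => k0; apply/eqP/sgI; rewrite k0 /sg s0.
  have [i' ->|->] := unliftP ord0 i; have [j' ->|->] := unliftP ord0 j => //.
  move/lift_inj; have [k ->|->] := unliftP ord0 i';
    have [m ->|->] := unliftP ord0 j' => //.
  - by move/sgI/slopeI ->.
  - by move/eqP; rewrite (negPf (sg0 _ (slope0 k))).
  - by move/esym/eqP; rewrite (negPf (sg0 _ (slope0 m))).
apply: (@affine_map_plane_isomorphic _ _ _ A affine7 L lines7 P infinity7 phi
  kappa) => //.
- exact: is_affine_plane7.
- exact: infinity7_inj.
- exact: disjoint_affine7.
- exact: affine7U_infinity7.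
(* The image of a line lies in the target line, and both have 7 points. *)
move=> i k; exists (G i k); apply/eqP; rewrite eqEcard; apply/andP; split.
  apply/subsetP=> _ /imsetP[p + ->]; rewrite LE !inE => /andP[pA /eqP <-].
  by rewrite phiA // class_phi // eqxx.
rewrite card_in_imset; last first.
  have sub := subsetP (affine_line_sub aff i k).
  by move=> p q pk qk; apply: phiI; apply: sub.
by rewrite (affine_line_card aff) (affine_line_card is_affine_plane7).
Qed.

End StandardPlane7.

Theorem theorem2p4 :
  [/\ ~ (exists (T : finType) (A : {set T}) (L : 'I_7 -> 'I_6 -> {set T}),
           is_affine_plane 6 A L),
      ~ (exists (T : finType) (Ls : {set {set T}}), is_projective_plane 6 Ls),
      (exists (T : finType) (Ls : {set {set T}}), is_projective_plane 7 Ls)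
    & forall (T1 T2 : finType) (Ls1 : {set {set T1}}) (Ls2 : {set {set T2}}),
        is_projective_plane 7 Ls1 -> is_projective_plane 7 Ls2 ->
        plane_isomorphic Ls1 Ls2].
Proof.
have no_affine6 (T : finType) (A : {set T}) (L : 'I_7 -> 'I_6 -> {set T}) :
    ~ is_affine_plane 6 A L.
  case/affine_plane_coordinates=>
    h /class_coordinates_ternary[F [_ [_ [_ [tF _ _ _ _]]]]] _.
  exact: no_ternary_ring6 tF.
split.
- by case=> T [A [L]]; apply: no_affine6.
- by case=> T [Ls [A [L [P [/no_affine6]]]]].
- exists point7, (projective_lines lines7 infinity7), affine7, lines7,
    infinity7; split=> //.
  + exact: is_affine_plane7.
  + exact: infinity7_inj.
  + exact: disjoint_affine7.
  + exact: affine7U_infinity7.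
- move=> T1 T2 Ls1 Ls2 /projective_plane7_standard iso1
    /projective_plane7_standard iso2.
  exact: plane_isomorphic_trans iso1 (plane_isomorphic_sym iso2).
Qed.
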